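(* Consider the scenario-oriented energy-reserve co-optimization model (II) described in the context, and assume $\underline G=0$ (the lower output bound of each generator is zero). Let $j$ be any generator, let $(g^*(j),r_U^*(j),r_D^*(j))$ be its procured quantities of energy and reserve in an optimal solution of (II), and let $(\eta^g(j),\eta^U(j),\eta^D(j))$ be its settlement prices defined in the context from associated optimal multipliers. Then $(g^*(j),r_U^*(j),r_D^*(j))$ is a maximizer of the profit $$F^{IV}_j(g(j),r_U(j),r_D(j))=\eta^g(j)g(j)+\eta^U(j)r_U(j)+\eta^D(j)r_D(j)-c_g(j)g(j)-c_U(j)r_U(j)-c_D(j)r_D(j)$$ over all $(g(j),r_U(j),r_D(j))\in\mathbb R^3$ satisfying generator $j$'s own constraints $$\underline G(j)+r_D(j)\le g(j),\quad g(j)+r_U(j)\le\overline G(j),\quad 0\le r_U(j)\le\overline{r_U}(j),\quad 0\le r_D(j)\le\overline{r_D}(j),$$ where the prices $\eta^g(j),\eta^U(j),\eta^D(j)$ are held fixed.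
   Context: Model (II). There are finitely many buses, generators $j$ (located at bus $m_j$), loads $l$ (located at bus $m_l$), and a finite set $\mathcal K$ of mutually exclusive non-base scenarios with given occurrence probabilities $\epsilon_k>0$, $\sum_{k\in\mathcal K}\epsilon_k\le 1$. The setting is single-period, lossless DC power flow; renewables are treated as negative loads; non-base scenarios may contain line outages and load fluctuations but no generator outages. Decision variables: generation $g$, upward reserve $r_U$, downward reserve $r_D$ (vectors over generators), and for each $k\in\mathcal K$ upward/downward re-dispatch $\delta g^U_k,\delta g^D_k$ (over generators) and load shedding $\delta d_k$ (over loads). Data: bid-in prices $c_g,c_U,c_D$, re-dispatch prices $\overline c,\underline c$, load-shedding prices $c_L$, base load $d$, load fluctuation $\pi_k$ (with $d+\pi_k\ge 0$), generation bounds $\underline G,\overline G$, reserve bounds $\overline{r_U},\overline{r_D}$, line limits $f$ (base) and $f_k$ (scenario $k$), shift-factor matrices $S_G,S_D$ (base) and $S_{G,k},S_{D,k}$ (scenario $k$) for generators and loads. Model (II) is the linear program $$\min\; F=c_g^Tg+c_U^Tr_U+c_D^Tr_D+\sum_{k\in\mathcal K}\epsilon_k(\overline c^T\delta g^U_k-\underline c^T\delta g^D_k+c_L^T\delta d_k)$$ subject to (multipliers in front) $(\lambda,\mu)$: $\mathbf 1^Tg=\mathbf 1^Td$, $S_Gg-S_Dd\le f$; $(\underline\upsilon,\overline\upsilon)$: $\underline G+r_D\le g$, $g+r_U\le\overline G$; $(\underline{\rho^U},\overline{\rho^U},\underline{\rho^D},\overline{\rho^D})$: $0\le r_U\le\overline{r_U}$,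 $0\le r_D\le\overline{r_D}$; and for all $k\in\mathcal K$: $\lambda_k$: $\mathbf 1^T(g+\delta g^U_k-\delta g^D_k)=\mathbf 1^T(d+\pi_k-\delta d_k)$; $\mu_k$: $S_{G,k}(g+\delta g^U_k-\delta g^D_k)-S_{D,k}(d+\pi_k-\delta d_k)\le f_k$; $(\underline{\alpha_k},\overline{\alpha_k})$: $0\le\delta g^U_k\le r_U$; $(\underline{\beta_k},\overline{\beta_k})$: $0\le\delta g^D_k\le r_D$; $(\underline{\tau_k},\overline{\tau_k})$: $0\le\delta d_k\le d+\pi_k$. Sign convention: the Lagrangian is $F$ plus $\lambda(\mathbf 1^Td-\mathbf 1^Tg)$, plus $\lambda_k(\mathbf 1^T(d+\pi_k-\delta d_k)-\mathbf 1^T(g+\delta g^U_k-\delta g^D_k))$ for each $k$, plus, for each inequality $a\le b$, its nonnegative multiplier times $(a-b)$. It is assumed that (II) has an optimal solution; superscript $*$ denotes optimal values and multipliers, fixed throughout. $S_G(\cdot,m_j)$ and $S_{G,k}(\cdot,m_j)$ denote the columns of $S_G$ and $S_{G,k}$ corresponding to generator $j$ (located at bus $m_j$). Prices of generator $j$: energy $\eta^g(j)=\lambda^*-S_G(\cdot,m_j)^T\mu^*+\sum_{k\in\mathcal K}(\lambda_k^*-S_{G,k}(\cdot,m_j)^T\mu_k^* )$; upward reserve $\eta^U(j)=\sum_{k\in\mathcal K}\overline{\alpha_k}^*(j)$; downward reserve $\eta^D(j)=\sum_{k\in\mathcal K}\overline{\beta_k}^*(j)$. *)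

(* Defs.v *)
From HB Require Import structures.
From mathcomp Require Import all_boot all_order all_algebra.
From mathcomp Require Import all_classical all_reals all_analysis.

Set Implicit Arguments.
Unset Strict Implicit.
Unset Printing Implicit Defensive.

Import Order.TTheory GRing.Theory Num.Theory.
Import numFieldNormedType.Exports.
Local Open Scope ring_scope.

Section Vectors.
Context {R : realType} {n : nat}.
Implicit Types u v : 'cV[R]_n.

Definition dot u v : R := \sum_i u i 0 * v i 0.
Definition total u : R := \sum_i u i 0.
Definition vle u v : Prop := forall i, u i 0 <= v i 0.

End Vectors.

(* nG generators, nL loads, nE lines in the base case, K the set of non-base
   scenarios, nEk k lines in scenario k (line outages may change the number
   of lines).  The bus of a generator or a load enters the model only through
   its column of the shift-factor matrices, so buses are not represented. *)
Record model (R : realType) (nG nL nE : nat) (K : finType) (nEk : K -> nat) :=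
  Model {
    c_g : 'cV[R]_nG;
    c_U : 'cV[R]_nG;
    c_D : 'cV[R]_nG;
    c_up : 'cV[R]_nG;               (* \overline c *)
    c_dn : 'cV[R]_nG;               (* \underline c *)
    c_L : 'cV[R]_nL;
    load : 'cV[R]_nL;
    fluct : K -> 'cV[R]_nL;         (* pi_k *)
    prob : K -> R;                  (* epsilon_k *)
    Gmin : 'cV[R]_nG;
    Gmax : 'cV[R]_nG;
    rUmax : 'cV[R]_nG;
    rDmax : 'cV[R]_nG;
    flim : 'cV[R]_nE;
    flimk : forall k, 'cV[R]_(nEk k);
    S_G : 'M[R]_(nE, nG);
    S_D : 'M[R]_(nE, nL);
    S_Gk : forall k, 'M[R]_(nEk k, nG);
    S_Dk : forall k, 'M[R]_(nEk k, nL)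
  }.

Record decision (R : realType) (nG nL : nat) (K : finType) := Decision {
  gen : 'cV[R]_nG;
  rU : 'cV[R]_nG;
  rD : 'cV[R]_nG;
  dgU : K -> 'cV[R]_nG;
  dgD : K -> 'cV[R]_nG;
  shed : K -> 'cV[R]_nL
}.

(* The suffix lo (up) marks the multiplier of a lower (upper) bound. *)
Record multipliers (R : realType) (nG nL nE : nat) (K : finType)
    (nEk : K -> nat) := Multipliers {
  lam : R;
  mu : 'cV[R]_nE;
  ups_lo : 'cV[R]_nG;
  ups_up : 'cV[R]_nG;
  rhoU_lo : 'cV[R]_nG;
  rhoU_up : 'cV[R]_nG;
  rhoD_lo : 'cV[R]_nG;
  rhoD_up : 'cV[R]_nG;
  lamk : K -> R;
  muk : forall k, 'cV[R]_(nEk k);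
  alpha_lo : K -> 'cV[R]_nG;
  alpha_up : K -> 'cV[R]_nG;
  beta_lo : K -> 'cV[R]_nG;
  beta_up : K -> 'cV[R]_nG;
  tau_lo : K -> 'cV[R]_nL;
  tau_up : K -> 'cV[R]_nL
}.

Section CoOptimization.
Context {R : realType} {nG nL nE : nat} {K : finType} {nEk : K -> nat}.
Variable M : model R nG nL nE nEk.
Implicit Types (x dx : decision R nG nL K) (y : multipliers R nG nL nE nEk).

Definition standing_assumptions : Prop :=
  [/\ forall k, 0 < prob M k,
      \sum_k prob M k <= 1
    & forall k, vle 0 (load M + fluct M k)].

Definition genk x k : 'cV[R]_nG := gen x + dgU x k - dgD x k.
Definition loadk x k : 'cV[R]_nL := load M + fluct M k - shed x k.
Definition flow x : 'cV[R]_nE := S_G M *m gen x - S_D M *m load M.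
Definition flowk x k : 'cV[R]_(nEk k) :=
  S_Gk M k *m genk x k - S_Dk M k *m loadk x k.

Definition cost x : R :=
  dot (c_g M) (gen x) + dot (c_U M) (rU x) + dot (c_D M) (rD x)
  + \sum_k prob M k * (dot (c_up M) (dgU x k) - dot (c_dn M) (dgD x k)
                       + dot (c_L M) (shed x k)).

Definition feasible_base x : Prop :=
  [/\ total (gen x) = total (load M) /\ vle (flow x) (flim M),
      vle (Gmin M + rD x) (gen x) /\ vle (gen x + rU x) (Gmax M),
      vle 0 (rU x) /\ vle (rU x) (rUmax M)
    & vle 0 (rD x) /\ vle (rD x) (rDmax M)].

Definition feasible_scenario x k : Prop :=
  [/\ total (genk x k) = total (loadk x k),
      vle (flowk x k) (flimk M k),
      vle 0 (dgU x k) /\ vle (dgU x k) (rU x),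
      vle 0 (dgD x k) /\ vle (dgD x k) (rD x)
    & vle 0 (shed x k) /\ vle (shed x k) (load M + fluct M k)].

Definition feasible x : Prop :=
  feasible_base x /\ forall k, feasible_scenario x k.

Definition optimal x : Prop :=
  feasible x /\ forall x', feasible x' -> cost x <= cost x'.

Definition lagrangian y x : R :=
  cost x
  + lam y * (total (load M) - total (gen x))
  + dot (mu y) (flow x - flim M)
  + dot (ups_lo y) (Gmin M + rD x - gen x)
  + dot (ups_up y) (gen x + rU x - Gmax M)
  + dot (rhoU_lo y) (0 - rU x) + dot (rhoU_up y) (rU x - rUmax M)
  + dot (rhoD_lo y) (0 - rD x) + dot (rhoD_up y) (rD x - rDmax M)
  + \sum_k (lamk y k * (total (loadk x k) - total (genk x k))
            + dot (muk y k) (flowk x k - flimk M k)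
            + dot (alpha_lo y k) (0 - dgU x k)
            + dot (alpha_up y k) (dgU x k - rU x)
            + dot (beta_lo y k) (0 - dgD x k)
            + dot (beta_up y k) (dgD x k - rD x)
            + dot (tau_lo y k) (0 - shed x k)
            + dot (tau_up y k) (shed x k - (load M + fluct M k))).

Definition dual_feasible y : Prop :=
  [/\ vle 0 (mu y),
      vle 0 (ups_lo y) /\ vle 0 (ups_up y),
      vle 0 (rhoU_lo y) /\ vle 0 (rhoU_up y),
      vle 0 (rhoD_lo y) /\ vle 0 (rhoD_up y)
    & forall k,
      [/\ vle 0 (muk y k),
          vle 0 (alpha_lo y k) /\ vle 0 (alpha_up y k),
          vle 0 (beta_lo y k) /\ vle 0 (beta_up y k)
        & vle 0 (tau_lo y k) /\ vle 0 (tau_up y k)]].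

Definition compl n (w a b : 'cV[R]_n) : Prop :=
  forall i, w i 0 * (a i 0 - b i 0) = 0.

Definition complementary_slackness x y : Prop :=
  [/\ compl (mu y) (flow x) (flim M),
      compl (ups_lo y) (Gmin M + rD x) (gen x) /\
      compl (ups_up y) (gen x + rU x) (Gmax M),
      compl (rhoU_lo y) 0 (rU x) /\ compl (rhoU_up y) (rU x) (rUmax M),
      compl (rhoD_lo y) 0 (rD x) /\ compl (rhoD_up y) (rD x) (rDmax M)
    & forall k,
      [/\ compl (muk y k) (flowk x k) (flimk M k),
          compl (alpha_lo y k) 0 (dgU x k) /\
          compl (alpha_up y k) (dgU x k) (rU x),
          compl (beta_lo y k) 0 (dgD x k) /\
          compl (beta_up y k) (dgD x k) (rD x)
        & compl (tau_lo y k) 0 (shed x k) /\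
          compl (tau_up y k) (shed x k) (load M + fluct M k)]].

Definition displace x dx (t : R) : decision R nG nL K :=
  Decision (gen x + t *: gen dx) (rU x + t *: rU dx) (rD x + t *: rD dx)
    (fun k => dgU x k + t *: dgU dx k) (fun k => dgD x k + t *: dgD dx k)
    (fun k => shed x k + t *: shed dx k).

(* The gradient of the Lagrangian in x vanishes: every directional derivative
   is 0. *)
Definition stationary x y : Prop :=
  forall dx, is_derive (0 : R) (1 : R)
    (fun t : R => lagrangian y (displace x dx t)) (0 : R).

(* Optimal multipliers associated with the optimal solution x, in the
   Karush-Kuhn-Tucker sense. *)
Definition optimal_multipliers x y : Prop :=
  [/\ dual_feasible y, complementary_slackness x y & stationary x y].

Definition eta_g y (j : 'I_nG) : R :=
  lam y - dot (col j (S_G M)) (mu y)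
  + \sum_k (lamk y k - dot (col j (S_Gk M k)) (muk y k)).
Definition eta_U y (j : 'I_nG) : R := \sum_k alpha_up y k j 0.
Definition eta_D y (j : 'I_nG) : R := \sum_k beta_up y k j 0.

(* q = (g(j), r_U(j), r_D(j)) *)
Definition gen_feasible (j : 'I_nG) (q : R * R * R) : Prop :=
  let: (gj, rUj, rDj) := q in
  [/\ Gmin M j 0 + rDj <= gj,
      gj + rUj <= Gmax M j 0,
      0 <= rUj <= rUmax M j 0
    & 0 <= rDj <= rDmax M j 0].

Definition gen_profit (pg pU pD : R) (j : 'I_nG) (q : R * R * R) : R :=
  let: (gj, rUj, rDj) := q in
  pg * gj + pU * rUj + pD * rDj
  - c_g M j 0 * gj - c_U M j 0 * rUj - c_D M j 0 * rDj.

End CoOptimization.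

Definition is_maximizer (R : realType) (T : Type) (A : T -> Prop) (f : T -> R)
    (q : T) : Prop :=
  A q /\ forall q', A q' -> f q' <= f q.

(* Main.v *)
(* Stationarity in the own variables of generator j expresses its unit margins
   as differences of multipliers of its own constraints, for instance
     eta_g - c_g = ups_up - ups_lo,
   because all other constraints act on these variables through the prices
   only.  With complementary slackness, the multipliers of the own constraints
   thus form an optimality certificate for the profit problem. *)
Require Import Defs.
From mathcomp Require Import all_boot all_order all_algebra.
From mathcomp Require Import all_classical all_reals all_analysis.
From mathcomp Require Import ring lra.
Import Order.TTheory GRing.Theory Num.Theory.
Import numFieldNormedType.Exports.
Local Open Scope ring_scope.

Section DotTheory.
Context {R : realType} {n : nat}.
Implicit Types u v w : 'cV[R]_n.

Lemma dotD w u v : dot w (u + v) = dot w u + dot w v.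
Proof. by rewrite -big_split; apply: eq_bigr => i _; rewrite mxE mulrDr. Qed.

Lemma dotZ w a u : dot w (a *: u) = a * dot w u.
Proof. by rewrite mulr_sumr; apply: eq_bigr => i _; rewrite mxE mulrCA. Qed.

Lemma dotN w u : dot w (- u) = - dot w u.
Proof. by rewrite -scaleN1r dotZ mulN1r. Qed.

Lemma dotC u v : dot u v = dot v u.
Proof. by apply: eq_bigr => i _; rewrite mulrC. Qed.

Lemma dot_delta w j : dot w (delta_mx j 0) = w j 0.
Proof.
rewrite /dot (bigD1 j)//= big1 ?addr0 => [|i /negPf ij].
  by rewrite mxE !eqxx mulr1.
by rewrite mxE ij mulr0.
Qed.

Lemma total_dot u : Defs.total u = dot (const_mx 1) u.
Proof. by apply: eq_bigr => i _; rewrite mxE mul1r. Qed.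

End DotTheory.

(** Test direction for stationarity, isolating the three variables that appear in the profit of
    [j]. *)
Definition unilateral {R : realType} {nG : nat} nL (K : finType) (j : 'I_nG)
    (a b c : R) : decision R nG nL K :=
  Decision (a *: delta_mx j 0) (b *: delta_mx j 0) (c *: delta_mx j 0)
    (fun=> 0) (fun=> 0) (fun=> 0).

Section OwnConstraints.
Context {R : realType} {nG nL nE : nat} {K : finType} {nEk : K -> nat}.
Variables (M : model R nG nL nE nEk) (x : decision R nG nL K).
Variables (y : multipliers R nG nL nE nEk) (j : 'I_nG).

(** The Lagrangian is affine in the decision, so the expansion is exact. Energy of [j] enters all
    balances and line limits, whose multipliers add up to [eta_g]; reserve enters the scenarios only
    as a cap on re-dispatch, which yields [eta_U] and [eta_D]. *)
Lemma lagrangian_unilateral a b c t :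
  lagrangian M y (displace x (unilateral nL K j a b c) t) =
  lagrangian M y x + t *
    (a * (c_g M j 0 - eta_g M y j - ups_lo y j 0 + ups_up y j 0)
     + b * (c_U M j 0 - eta_U y j + ups_up y j 0
            - rhoU_lo y j 0 + rhoU_up y j 0)
     + c * (c_D M j 0 - eta_D y j + ups_lo y j 0
            - rhoD_lo y j 0 + rhoD_up y j 0)).
Proof.
rewrite /lagrangian.
under eq_bigr => k _ do
  rewrite /flowk /genk /loadk /displace /= !scaler0 !addr0.
have -> : cost M (displace x (unilateral nL K j a b c) t) =
    cost M x + t * (a * c_g M j 0 + b * c_U M j 0 + c * c_D M j 0).
  rewrite /cost /=; under eq_bigr => k _ do rewrite !scaler0 !addr0.
  by rewrite !dotD !dotZ !dot_delta; ring.
set S := \sum_k _; set S' := \sum_k _.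
have -> : S = S' + t * (a * \sum_k (dot (col j (S_Gk M k)) (muk y k) - lamk y k)
    - b * eta_U y j - c * eta_D y j).
  rewrite /S /S' /eta_U /eta_D !mulr_sumr -!sumrB mulr_sumr -big_split /=.
  apply: eq_bigr => k _.
  rewrite /flowk /genk /loadk !total_dot !mulmxDr !mulmxN -!scalemxAr.
  (* A shift-factor matrix applied to a unit injection at [j] is its column [j], the form used in
     the price. *)
  rewrite -colE !(dotD, dotN, dotZ) !dot_delta mxE.
  by rewrite (dotC (muk y k) (col _ _)); ring.
(* The sign is flipped so that the scenario sum coincides with the one in the previous identity and
   [ring] sees a single atom. *)
have -> : eta_g M y j = lam y - dot (col j (S_G M)) (mu y)
    - \sum_k (dot (col j (S_Gk M k)) (muk y k) - lamk y k).
  by congr +%R; rewrite -sumrN; apply: eq_bigr => k _; rewrite opprB.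
rewrite /flow /= !total_dot mulmxDr -!scalemxAr.
rewrite -colE !(dotD, dotN, dotZ) !dot_delta mxE.
by rewrite (dotC (mu y) (col _ _)); ring.
Qed.

Lemma stationary_margins : stationary M x y ->
  [/\ eta_g M y j - c_g M j 0 = ups_up y j 0 - ups_lo y j 0,
      eta_U y j - c_U M j 0 = ups_up y j 0 - rhoU_lo y j 0 + rhoU_up y j 0
    & eta_D y j - c_D M j 0 = ups_lo y j 0 - rhoD_lo y j 0 + rhoD_up y j 0].
Proof.
move=> st.
have affine (A B : R) : is_derive (0 : R) (1 : R) (fun t : R => A + t * B) B.
  have -> : (fun t => A + t * B) = cst A + B \*: id.
    by apply/funext => t /=; rewrite [t * B]mulrC.
  by apply: is_derive_eq; rewrite add0r [LHS]mulr1.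
(* The same derivative is 0 by stationarity and [B] by affinity. *)
have slope0 a b c B : (forall t, lagrangian M y
    (displace x (unilateral nL K j a b c) t) = lagrangian M y x + t * B) -> B = 0.
  move=> E; have := st (unilateral nL K j a b c); rewrite (funext E) => d.
  by rewrite -(@derive_val _ _ _ _ _ _ _ d) (@derive_val _ _ _ _ _ _ _ (affine _ _)).
have H a b c := slope0 a b c _ (lagrangian_unilateral a b c).
(* The three unit directions isolate the coefficients of energy, upward and downward reserve. *)
by have := H 1 0 0; have := H 0 1 0; have := H 0 0 1; split; lra.
Qed.

End OwnConstraints.

Theorem theorem3 (R : realType) (nG nL nE : nat) (K : finType)
    (nEk : K -> nat) (M : model R nG nL nE nEk)
    (x : decision R nG nL K) (y : multipliers R nG nL nE nEk) (j : 'I_nG) :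
  standing_assumptions M ->
  Gmin M = 0 ->
  optimal M x ->
  optimal_multipliers M x y ->
  is_maximizer (gen_feasible M j)
    (gen_profit M (eta_g M y j) (eta_U y j) (eta_D y j) j)
    (gen x j 0, rU x j 0, rD x j 0).
Proof.
move=> _ _ [[[_ [glo gup] [Ulo Uup] [Dlo Dup]] _] _].
move=> [[_ [ul0 uu0] [Ul0 Uu0] [Dl0 Du0] _] [_ [cl cu] [cUl cUu] [cDl cDu] _]].
move=> /(stationary_margins M x y j) [mg mU mD].
move: (glo j) (gup j) (Ulo j) (Uup j) (Dlo j) (Dup j).
move: (ul0 j) (uu0 j) (Ul0 j) (Uu0 j) (Dl0 j) (Du0 j).
move: (cl j) (cu j) (cUl j) (cUu j) (cDl j) (cDu j).
rewrite !mxE => sl su sUl sUu sDl sDu pl pu pUl pUu pDl pDu fl fu fUl fUu fDl fDu.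
split; first by split=> //; apply/andP.
move=> [[g u] d] [qg qu /andP[u0 u1] /andP[d0 d1]] /=.
(* Weak duality: every own constraint of the competing point, weighted by its multiplier,
   contributes a nonpositive term; at the optimum these terms are 0. *)
have weigh (w a b : R) : 0 <= w -> a <= b -> w * (a - b) <= 0.
  by move=> w0 ab; rewrite mulr_ge0_le0// subr_le0.
move: (weigh _ _ _ pl qg) (weigh _ _ _ pu qu) (weigh _ _ _ pUl u0).
move: (weigh _ _ _ pUu u1) (weigh _ _ _ pDl d0) (weigh _ _ _ pDu d1).
(* With the prices eliminated, the profit gap is the sum of the weighted terms at the competitor
   minus that at the optimum, linear in products of multipliers with quantities or bounds, so [lra]
   concludes. *)
have -> : eta_g M y j = c_g M j 0 + ups_up y j 0 - ups_lo y j 0 by lra.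
have -> : eta_U y j = c_U M j 0 + ups_up y j 0 - rhoU_lo y j 0 + rhoU_up y j 0.
  by lra.
have -> : eta_D y j = c_D M j 0 + ups_lo y j 0 - rhoD_lo y j 0 + rhoD_up y j 0.
  by lra.
lra.
Qed.
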